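(* Let $a\in R$. If $a\in R^{WD\dagger}$ (i.e. $a$ is weak Drazin Moore-Penrose invertible), then $a\in R^{d,\dagger}$ (i.e. $a$ is DMP invertible).
   Context: $R$ is a proper unital ring with involution: an associative ring with $1$ and a map $*:R\to R$ with $(a+b)^*=a^*+b^*$, $(ab)^*=b^*a^*$, $(a^* )^*=a$, such that $a^*a=0$ implies $a=0$. Moore-Penrose inverse: $a^\dagger$ is the unique $x$ (if it exists) with $axa=a$, $xax=x$, $(ax)^*=ax$, $(xa)^*=xa$; $R^\dagger$ is the set of Moore-Penrose invertible elements. Weak Drazin (WD) inverse: $a\in R$ is WD invertible if there are $x\in R$ and a positive integer $k$ with $axa=a$, $a^{k+1}x=a^k$, $xa^{k+1}=a^k$. The least positive integer $k$ for which such an $x$ exists is the weak Drazin index $\mathrm{ind}(a)$; any $x$ satisfying the three equations with $k=\mathrm{ind}(a)$ is a WD inverse of $a$ (not unique in general), denoted $a^{WD}$. $R^{WD}$ is the set of WD invertible elements. WDMP inverse: for $a\in R^{WD}\cap R^\dagger$, an element $y\in R$ is a WDMP inverse of $a$ if, for some WD inverse $a^{WD}$ of $a$ and $k=\mathrm{ind}(a)$, $yay=y$, $ay=aa^\dagger$, $ya^k=a^{WD}a^k$. $R^{WD\dagger}$ is the set of elements of $R^{WD}\cap R^\dagger$ having a WDMP inverse. Drazin inverse: $a\in R$ is Drazin invertible ($a\in R^d$) if there is a (necessarily unique) $x\in R$, denoted $a^d$, with $xa^{k+1}=a^k$, $ax=xa$, $ax^2=x$ for some positive integer $k$. DMP inverse: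 for $a\in R^d\cap R^\dagger$, a DMP inverse of $a$ is an element $x$ with $xax=x$, $xa=a^da$, $a^kx=a^ka^\dagger$ for some positive integer $k$; $R^{d,\dagger}$ is the set of DMP invertible elements. *)

(* Defs.v *)
From mathcomp Require Import all_boot all_algebra.
Set Implicit Arguments.
Unset Strict Implicit.
Unset Printing Implicit Defensive.
Import GRing.Theory.
Local Open Scope ring_scope.

Definition involution (R : pzRingType) (star : R -> R) : Prop :=
  [/\ forall a b : R, star (a + b) = star a + star b,
      forall a b : R, star (a * b) = star b * star a
    & forall a : R, star (star a) = a].

Definition proper_star (R : pzRingType) (star : R -> R) : Prop :=
  forall a : R, star a * a = 0 -> a = 0.

Definition MP_inverse (R : pzRingType) (star : R -> R) (a x : R) : Prop :=
  [/\ a * x * a = a, x * a * x = x,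
      star (a * x) = a * x & star (x * a) = x * a].

Definition MP_invertible (R : pzRingType) (star : R -> R) (a : R) : Prop :=
  exists x : R, MP_inverse star a x.

Definition WD_equations (R : pzRingType) (a x : R) (k : nat) : Prop :=
  [/\ a * x * a = a, a ^+ k.+1 * x = a ^+ k & x * a ^+ k.+1 = a ^+ k].

Definition WD_invertible (R : pzRingType) (a : R) : Prop :=
  exists (x : R) (k : nat), (0 < k)%N /\ WD_equations a x k.

Definition WD_index (R : pzRingType) (a : R) (k : nat) : Prop :=
  [/\ (0 < k)%N, exists x : R, WD_equations a x k
    & forall j : nat, (0 < j)%N -> (exists x : R, WD_equations a x j) ->
        (k <= j)%N].

Definition WD_inverse (R : pzRingType) (a x : R) : Prop :=
  exists k : nat, WD_index a k /\ WD_equations a x k.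

Definition drazin_inverse (R : pzRingType) (a x : R) : Prop :=
  exists k : nat, (0 < k)%N /\
    [/\ x * a ^+ k.+1 = a ^+ k, a * x = x * a & a * x ^+ 2 = x].

Definition drazin_invertible (R : pzRingType) (a : R) : Prop :=
  exists x : R, drazin_inverse a x.

Lemma MP_inverse_uniq (R : pzRingType) (star : R -> R) (a x y : R) :
  involution star -> MP_inverse star a x -> MP_inverse star a y -> x = y.
Proof.
move=> [_ sM _] [x1 x2 x3 x4] [y1 y2 y3 y4].
have ax_ay : a * x = a * y.
  by rewrite -x3 -{1}y1 -(mulrA (a * y)) sM x3 y3 mulrA x1.
have xa_ya : x * a = y * a.
  rewrite -x4 -{1}y1 (_ : x * (a * y * a) = (x * a) * (y * a)) ?mulrA //.
  by rewrite -mulrA sM x4 y4 -mulrA (mulrA a) x1.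
by rewrite -x2 -mulrA ax_ay mulrA xa_ya y2.
Qed.

Lemma drazin_inverse_uniq (R : pzRingType) (a x y : R) :
  drazin_inverse a x -> drazin_inverse a y -> x = y.
Proof.
have powl (z : R) n : a * z = z * a -> a * z ^+ 2 = z ->
    z = a ^+ n * z ^+ n.+1.
  move=> zC z2; elim: n => [|n IHn]; first by rewrite expr0 mul1r.
  by rewrite {1}IHn (exprSr a) -mulrA -(add2n n) exprD (mulrA a) z2 -exprS.
have powr (z : R) n : a * z = z * a -> a * z ^+ 2 = z ->
    z = z ^+ n.+1 * a ^+ n.
  move=> zC z2; rewrite {1}(powl z n zC z2).
  exact: (commrX n.+1 (commr_sym (commrX n (commr_sym zC)))).
have mono (z : R) k m : z * a ^+ k.+1 = a ^+ k -> z * a ^+ (k + m).+1 = a ^+ (k + m).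
  by move=> zk; rewrite -addSn exprD mulrA zk -exprD.
move=> [k [_ [xk xC x2]]] [l [_ [yl yC y2]]].
have xn := mono x k l xk; have yn := mono y l k yl.
rewrite addnC in yn; set n := (k + l)%N in xn yn.
have yn' : a ^+ n.+1 * y = a ^+ n.
  by rewrite -[RHS]yn; apply/commr_sym/commrX/commr_sym.
have -> : x = x * a * y.
  rewrite {1}(powr x n xC x2) -yn' (exprSr a) !mulrA; congr (_ * _ * _).
  by rewrite -powr.
rewrite -mulrA {1}(powl y n yC y2) !mulrA -(mulrA x) -exprS xn.
by rewrite -powl.
Qed.

(* The elements written a^\dagger and a^d are handled relationally: they are
   bound existentially, which pins them down by the uniqueness lemmas above. *)
Definition WDMP_inverse (R : pzRingType) (star : R -> R) (a y : R) : Prop :=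
  exists (p x : R) (k : nat),
    [/\ MP_inverse star a p, WD_inverse a x & WD_index a k] /\
    [/\ y * a * y = y, a * y = a * p & y * a ^+ k = x * a ^+ k].

Definition WDMP_invertible (R : pzRingType) (star : R -> R) (a : R) : Prop :=
  [/\ WD_invertible a, MP_invertible star a
    & exists y : R, WDMP_inverse star a y].

Definition DMP_inverse (R : pzRingType) (star : R -> R) (a x : R) : Prop :=
  exists (p d : R), MP_inverse star a p /\ drazin_inverse a d /\
    [/\ x * a * x = x, x * a = d * a
      & exists k : nat, (0 < k)%N /\ a ^+ k * x = a ^+ k * p].

Definition DMP_invertible (R : pzRingType) (star : R -> R) (a : R) : Prop :=
  [/\ drazin_invertible a, MP_invertible star a
    & exists x : R, DMP_inverse star a x].

(* Main.v *)
Require Import Defs.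
From mathcomp Require Import all_boot all_algebra.

(** If [a ^+ k.+1 * x = a ^+ k = x * a ^+ k.+1], then multiplying by [x] on
either side gives [x * a ^+ k = x * a ^+ k.+1 * x = a ^+ k * x]: [x] commutes
with [a ^+ k], so [a ^+ k * x ^+ k.+1] is the Drazin inverse [d] of [a].
If moreover [p] is the Moore-Penrose inverse of [a], then [d * a * p] is a DMP
inverse. *)

Set Implicit Arguments.
Unset Strict Implicit.
Unset Printing Implicit Defensive.
Import GRing.Theory.
Local Open Scope ring_scope.

Lemma WD_equations_comm (R : pzRingType) (a x : R) (k : nat) :
  WD_equations a x k -> GRing.comm x (a ^+ k).
Proof.
by move=> [_ ax xa]; rewrite /GRing.comm -{1}ax mulrA xa.
Qed.

Lemma WD_equations_drazin (R : pzRingType) (a x : R) (k : nat) :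
  (0 < k)%N -> WD_equations a x k -> drazin_inverse a (a ^+ k * x ^+ k.+1).
Proof.
move=> k_gt0 wd; have xC := WD_equations_comm wd; have [_ ax xa] := wd.
have cX n : x ^+ n * a ^+ k = a ^+ k * x ^+ n.
  exact/commr_sym/commrX/commr_sym.
(* Each [x] on the left cancels one [a] as long as [a ^+ k] remains; used below with [n = k.+1] and
   [n = k]. *)
have xaX n : x ^+ n * a ^+ (k + n) = a ^+ k.
  elim: n => [|n IHn]; first by rewrite mul1r addn0.
  by rewrite exprSr -mulrA addnS -addSn exprD (mulrA x) xa -exprD IHn.
have ad : a * (a ^+ k * x ^+ k.+1) = a ^+ k * x ^+ k.
  by rewrite mulrA -exprS (exprS x) mulrA ax.
exists k; split=> //; split.
- by rewrite -cX -mulrA -exprD xaX.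
(* On the right, once [x ^+ k.+1] is in front, its last factor [x] absorbs the extra [a]. *)
- by rewrite ad -[in RHS]cX -mulrA -exprSr (exprSr x) -mulrA xa cX.
- by rewrite expr2 mulrA ad -[in LHS]cX !mulrA -(mulrA (x ^+ k)) -exprD xaX.
Qed.

(** As [a * p * a = a], right multiplication by [a] reduces [d * a * p] to [d * a]; as [d] commutes
    with [a ^+ k], [a ^+ k * d * a] is [d * a ^+ k.+1 = a ^+ k]. *)
Lemma drazin_MP_DMP_inverse (R : pzRingType) (star : R -> R) (a d p : R) :
  drazin_inverse a d -> MP_inverse star a p -> DMP_inverse star a (d * a * p).
Proof.
move=> dz mp; have [k [k_gt0 [dk dC d2]]] := dz; have [apa _ _ _] := mp.
have dapa : d * a * p * a = d * a by rewrite -!mulrA (mulrA a p) apa.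
have dad : d * a * d = d by rewrite -dC -mulrA -expr2.
exists p, d; split=> //; split=> //; split=> //.
- by rewrite dapa !mulrA dad.
- exists k; split=> //.
  have dCk : GRing.comm d (a ^+ k) by apply: commrX; rewrite /GRing.comm dC.
  by rewrite !mulrA -dCk -(mulrA d) -exprSr dk.
Qed.

Theorem corollary2p5 (R : pzRingType) (star : R -> R)
  (star_inv : involution star) (star_proper : proper_star star) (a : R) :
  WDMP_invertible star a -> DMP_invertible star a.
Proof.
move=> [[x [k [k_gt0 wd]]] [p mp] _].
have dz := WD_equations_drazin k_gt0 wd.
split; [by eexists; exact: dz | by exists p |].
by eexists; exact: drazin_MP_DMP_inverse dz mp.
Qed.
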